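(* Let $a,r$ be even positive integers with $a>r$. The subtraction game $\mathcal{S}(1,a,a+r)$ is periodic with period $2a+r$ and nim-sequence $(01)^{a/2}\,2\,(01)^{a/2}(23)^{r/2-1}\,2$. Moreover, the subtraction set has expansion $\{1,a,a+2,a+4,\ldots,a+r,2a+r-1\}^{*(2a+r)}$ (where $a,a+2,\ldots,a+r$ are all even integers from $a$ to $a+r$).
   Context: For a finite set $S$ of positive integers, the subtraction game $\mathcal{S}(S)$ is played on a single pile: two players alternately remove $s\in S$ coins (at most the pile size); the last mover wins. The nim-value is $\mathcal{G}(n)=\operatorname{mex}\{\mathcal{G}(n-s): s\in S, s\le n\}$. Words of single digits are written by juxtaposition, and $x^m$ denotes $m$-fold repetition of the block $x$ ($x^0$ is empty). ''The game is periodic with period $p$ and nim-sequence $W$'' ($W$ a word of length $p$) means $\mathcal{G}(n+p)=\mathcal{G}(n)$ for all $n\ge0$, $p$ is the least such, and $\mathcal{G}(n)$ is the $((n\bmod p)+1)$-st letter of $W$ for all $n\ge0$. The expansion of $S$ is $S^{ex}=\{s\ge1:\mathcal{G}(n+s)\ne\mathcal{G}(n)\ \forall n\ge0\}$; ''has expansion $T$'' means $S^{ex}=T$. For a set $X$ and $p\ge1$, $X^{*p}=\{x+mp:x\in X,m\ge0\}$.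
   Formalization: For r = 2 the word is the square of (01)^{a/2} 2, so the least period is at most a+1, not 2a+2; the claim that 2a+r is the least period is therefore made only for r ≠ 2, all other claims being kept for every r. *)

(* Defs.v *)
From mathcomp Require Import all_boot.
From mathcomp Require Import finmap.
From mathcomp Require Import classical_sets.

Set Implicit Arguments.
Unset Strict Implicit.
Unset Printing Implicit Defensive.

Local Open Scope classical_set_scope.

(* The minimal excluded value of s is at most size s, so the search range
   always contains a witness (see mex_notin and mex_min). *)
Definition mex (s : seq nat) : nat :=
  find (fun k => k \notin s) (iota 0 (size s).+1).

(* [:: G 0; ...; G n.-1], where G is the nim-value function of S(S). *)
Fixpoint nim_prefix (S : {fset nat}) (n : nat) : seq nat :=
  if n is m.+1 then
    let g := nim_prefix S m in
    rcons g (mex [seq nth 0 g (m - s) | s <- S & s <= m])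
  else [::].

(* Meaningful when 0 \notin S: nim_valueE is then the defining recursion. *)
Definition nim_value (S : {fset nat}) (n : nat) : nat :=
  nth 0 (nim_prefix S n.+1) n.

Definition is_period (G : nat -> nat) (p : nat) : Prop :=
  0 < p /\ forall n, G (n + p) = G n.

Definition least_period (G : nat -> nat) (p : nat) : Prop :=
  is_period G p /\ forall q, is_period G q -> p <= q.

(* Minimality of p is kept apart, as least_period: for S = {1, a, a + 2} with a
   even, the word (01)^(a/2) 2 (01)^(a/2) 2 of length 2a + 2 is a square, so the
   least period is only a + 1. *)
Definition has_nim_sequence (S : {fset nat}) (p : nat) (W : seq nat) : Prop :=
  [/\ size W = p, is_period (nim_value S) p
    & forall n, nim_value S n = nth 0 W (n %% p)].

Definition word_pow (x : seq nat) (m : nat) : seq nat := flatten (nseq m x).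

Definition expansion (S : {fset nat}) : set nat :=
  [set s | 1 <= s /\ forall n, nim_value S (n + s) <> nim_value S n].

Definition star (X : set nat) (p : nat) : set nat :=
  [set x + m * p | x in X & m in [set: nat]].

Lemma mex_has (s : seq nat) :
  has (fun k => k \notin s) (iota 0 (size s).+1).
Proof.
apply/negPn/negP => /hasPn all_in.
have sub : {subset iota 0 (size s).+1 <= s}.
  by move=> k /all_in; rewrite negbK.
by have := uniq_leq_size (iota_uniq _ _) sub; rewrite size_iota ltnn.
Qed.

Lemma mex_notin (s : seq nat) : mex s \notin s.
Proof.
have h := mex_has s; have := nth_find 0 h.
by move: h; rewrite has_find size_iota => h; rewrite nth_iota.
Qed.

Lemma mex_min (s : seq nat) (k : nat) : k < mex s -> k \in s.
Proof.
move=> lt_k; have := before_find 0 lt_k.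
have := mex_has s; rewrite has_find size_iota => h.
by rewrite nth_iota ?add0n ?(ltn_trans lt_k h) // => /negbFE.
Qed.

Lemma size_nim_prefix (S : {fset nat}) (n : nat) : size (nim_prefix S n) = n.
Proof. by elim: n => //= n IHn; rewrite size_rcons IHn. Qed.

Lemma nth_nim_prefix (S : {fset nat}) (n k : nat) :
  k < n -> nth 0 (nim_prefix S n) k = nim_value S k.
Proof.
elim: n => // n IHn; rewrite ltnS leq_eqVlt => /predU1P[-> //|lt_kn] /=.
by rewrite nth_rcons size_nim_prefix lt_kn IHn.
Qed.

Lemma nim_valueE (S : {fset nat}) (n : nat) : 0 \notin S ->
  nim_value S n = mex [seq nim_value S (n - s) | s <- S & s <= n].
Proof.
move=> S0; rewrite /nim_value /= nth_rcons size_nim_prefix ltnn eqxx.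
congr mex; apply/eq_in_map => s; rewrite mem_filter => /andP[le_sn Ss].
apply: nth_nim_prefix; case: s le_sn Ss => [_ /(negP S0) //|s le_sn _].
by rewrite ltn_subrL /= (leq_ltn_trans _ le_sn).
Qed.

(* Main.v *)
(* Let p = 2a + r, let g be the p-periodic sequence with the announced period,
   and let X be the set of residues of the announced expansion.
   A case analysis on n mod p shows that g (n + t) <> g n for t in X.  Since X
   contains 1, a and a + r, no option of n has value g n; moreover each value
   below g n is reached without wrapping around the period, so g satisfies the
   recursion of the nim-values also for small n.  For a residue t outside X, two
   zeros of g at distance t modulo p show that t is not in the expansion.
   If r > 2, the factor 20 of g occurs cyclically only at a and at 2a + r - 1;
   it is preceded by 1 at the former place and by 3 at the latter, so no shift
   shorter than p preserves g. *)
Require Import Defs.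
From mathcomp Require Import all_boot.
From mathcomp Require Import finmap.
From mathcomp Require Import classical_sets.
From mathcomp Require Import zify.

Local Open Scope classical_set_scope.

Lemma mex_eq (s : seq nat) (k : nat) :
  k \notin s -> (forall j, j < k -> j \in s) -> mex s = k.
Proof.
move=> kNs lt_k; case: (ltngtP (mex s) k) => // [/lt_k | /mex_min].
- by rewrite (negPf (mex_notin s)).
- by rewrite (negPf kNs).
Qed.

Lemma size_word_pow (x : seq nat) (m : nat) : size (word_pow x m) = m * size x.
Proof. by elim: m => //= m IHm; rewrite size_cat -/(word_pow x m) IHm mulSn. Qed.

Lemma nth_word_pow2 (x y m i : nat) : i < 2 * m ->
  nth 0 (word_pow [:: x; y] m) i = if odd i then y else x.
Proof.
elim: m i => [|m IHm] [|[|i]] //= lt_i.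
by rewrite -/(word_pow _ m) IHm ?negbK //; lia.
Qed.

(** For even [a] and [r], the second block (01)^(a/2) starts at the odd position [a + 1], hence the
    reversed parity there; the final 2, at an odd position, prolongs the (23) pattern. *)
Definition letter (a r t : nat) : nat :=
  if t < a then odd t : nat
  else if t == a then 2
  else if t <= 2 * a then ~~ odd t : nat
  else if odd t then 2 else 3.

Ltac letter_cases := rewrite /letter; repeat (case: ifP => ?; try lia); lia.

Definition nim_candidate (a r n : nat) : nat := letter a r (n %% (2 * a + r)).

Definition residue_set (a r : nat) : set nat :=
  [set 1] `|` [set s | ~~ odd s /\ a <= s <= a + r] `|` [set 2 * a + r - 1].

Section SubtractionGame.

Variables (a r : nat).
Hypotheses (ha : 0 < a) (hr : 0 < r) (ha_even : ~~ odd a) (hr_even : ~~ odd r).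
Hypothesis hra : r < a.

Local Notation p := (2 * a + r).
Local Notation F := (letter a r).
Local Notation g := (nim_candidate a r).
Local Notation S := [fset 1; a; (a + r)%N]%fset.

Lemma nim_candidateD n s : s < p ->
  g (n + s) = if n %% p + s < p then F (n %% p + s) else F (n %% p + s - p).
Proof.
move=> lt_s; rewrite /nim_candidate modnD; last by lia.
rewrite (modn_small lt_s) leqNgt.
by case: ifP => _; rewrite ?mul0n ?subn0 ?mul1n.
Qed.

(** Residues 1 and [p - 1] compare cyclic neighbours. An even shift in [a, a + r] sends each (01)
    block into the other, of opposite parity, or to letters at least 2; the 2 at [a] goes to 0, 1 or
    3, and letters past [2 * a] go to 0, 1 or, from a 3 only, to the 2 at [a]. *)
Lemma nim_candidate_neq n t : residue_set a r t -> g (n + t) <> g n.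
Proof.
move=> Xt; have lt_tp : t < p by case: Xt => [[->|[_ /andP[]]]|->] /=; lia.
rewrite nim_candidateD // /nim_candidate.
have : n %% p < p by rewrite ltn_mod; lia.
move: (n %% p) => u lt_u.
case: Xt => [[->|[t_even /andP[le_at le_ta]]]|->]; letter_cases.
Qed.

Lemma residue_set_witness t : t < p -> ~ residue_set a r t ->
  exists n, g (n + t) = g n.
Proof.
move=> lt_tp NXt.
have [t1 tp] : t <> 1 /\ t <> p - 1 by split=> E; apply: NXt; [left; left|right].
have t_mid : ~~ (~~ odd t && (a <= t <= a + r)).
  by apply/negP => /andP[? ?]; apply: NXt; left; right; split.
have wit n : n < p ->
    (if n + t < p then F (n + t) else F (n + t - p)) = F n ->
    exists n, g (n + t) = g n.
  by move=> lt_n E; exists n; rewrite nim_candidateD // /nim_candidate modn_small.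
(* Zeros sit at even positions below [a] and at odd positions between [a] and [2 * a]. An odd [t]
   joins one of each kind, the first being 0 or [a - 2]; an even [t] joins 0 to a zero of the first
   kind. *)
case t_odd: (odd t).
- have [lt_ta|le_at] := ltnP t a; first by apply: (wit (a - 2)); letter_cases.
  have [le_t2a|lt_2at] := leqP t (2 * a); first by apply: (wit 0); letter_cases.
  by apply: (wit (p - t + a - 2)); letter_cases.
- have [lt_ta|le_at] := ltnP t a; first by apply: (wit 0); letter_cases.
  by apply: (wit (p - t)); letter_cases.
Qed.

(** A letter 1 follows a 0. At [a], the moves [a] and 1 reach 0 and 1. Past [2 * a], the moves [a]
    and [a + r] reach the second and the first (01) block, giving 0 and 1 in an order set by the
    parity of [t], and the move 1 leads from 3 to 2. *)
Lemma letter_option t j : t < p -> j < F t ->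
  exists2 s, s \in S & s <= t /\ F (t - s) = j.
Proof.
move=> lt_tp lt_j.
have S_in s : [|| s == 1, s == a | s == a + r] -> s \in S.
  by rewrite !inE orbA.
have [E|[E|E]] : (1 <= t /\ F (t - 1) = j) \/ (a <= t /\ F (t - a) = j)
    \/ (a + r <= t /\ F (t - (a + r)) = j).
- by move: lt_j; letter_cases.
- by exists 1 => //; apply: S_in; rewrite eqxx.
- by exists a => //; apply: S_in; rewrite eqxx orbT.
- by exists (a + r) => //; apply: S_in; rewrite eqxx !orbT.
Qed.

Lemma nim_valueE_candidate n : nim_value S n = g n.
Proof.
have S0 : 0 \notin S by rewrite !inE; lia.
elim/ltn_ind: n => n IHn; rewrite nim_valueE //.
have -> : [seq nim_value S (n - s) | s <- S & s <= n]
        = [seq g (n - s) | s <- S & s <= n].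
  apply/eq_in_map => s; rewrite mem_filter => /andP[le_sn Ss]; apply: IHn.
  by case: s le_sn Ss => [_ /(negP S0) //|s le_sn _]; lia.
apply: mex_eq => [|j lt_j].
- apply/mapP => -[s]; rewrite mem_filter => /andP[le_sn Ss] E.
  have Xs : residue_set a r s.
    move: Ss; rewrite !inE => /orP[/orP[]|] /eqP->; first by left; left.
    + by left; right; split=> //; lia.
    + by left; right; split; lia.
  by apply: (nim_candidate_neq (n - s) s Xs); rewrite subnK.
- have lt_tp : n %% p < p by rewrite ltn_mod; lia.
  have [s Ss [le_s <-]] := letter_option _ _ lt_tp lt_j.
  apply/mapP; exists s; first by rewrite mem_filter Ss (leq_trans le_s (leq_mod _ _)).
  rewrite /nim_candidate; congr (F _).
  (* Since [s <= n %% p], the move stays within the same period. *)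
  by rewrite [in RHS](divn_eq n p) -addnBA // modnMDl [RHS]modn_small //; lia.
Qed.

Lemma nim_candidate_period n : g (n + p) = g n.
Proof. by rewrite /nim_candidate modnDr. Qed.

Lemma nth_nim_word t : t < p ->
  nth 0 (word_pow [:: 0; 1] (a./2) ++ [:: 2] ++ word_pow [:: 0; 1] (a./2) ++
         word_pow [:: 2; 3] (r./2 - 1) ++ [:: 2]) t = F t.
Proof.
move=> lt_tp; rewrite !nth_cat !size_word_pow /=.
case: ifP => ?; first by rewrite nth_word_pow2; letter_cases.
case: ifP => ?; first by rewrite (_ : t - _ = 0) /=; letter_cases.
case: ifP => ?; first by rewrite nth_word_pow2; letter_cases.
case: ifP => ?; first by rewrite nth_word_pow2; letter_cases.
by rewrite (_ : _ - _ = 0) /=; letter_cases.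
Qed.

Lemma nim_candidate_least_period : r <> 2 -> least_period g p.
Proof.
move=> r2; split=> [|q [q_gt0 gq]]; first by split; [lia | exact: nim_candidate_period].
rewrite leqNgt; apply/negP => lt_qp.
have E n : n < p -> (if n + q < p then F (n + q) else F (n + q - p)) = F n.
  by move=> lt_n; move: (gq n); rewrite nim_candidateD // /nim_candidate modn_small.
(* These three positions carry 120, which would have to recur [q] places further on. *)
have := E (a - 1) ltac:(lia); have := E a ltac:(lia); have := E (a + 1) ltac:(lia).
letter_cases.
Qed.

Lemma nim_candidate_expansion :
  [set s | 1 <= s /\ forall n, g (n + s) <> g n] = star (residue_set a r) p.
Proof.
have gD n t m : g (n + (t + m * p)) = g (n + t).
  by rewrite /nim_candidate addnA addnC modnMDl.
apply/seteqP; split=> s /=.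
- move=> [s_gt0 gs]; exists (s %% p); last first.
    by exists (s %/ p) => //; rewrite addnC -divn_eq.
  apply: boolp.contrapT => NX.
  (* A witness against the residue of [s] also refutes [s], as multiples of [p] do not change
     [g]. *)
  have [|n E] := residue_set_witness (s %% p) _ NX; first by rewrite ltn_mod; lia.
  by apply: (gs n); rewrite [in LHS](divn_eq s p) [_ * p + _]addnC gD.
- move=> [t Xt [m _ <-]]; split=> [|n].
    by case: Xt => [[->|[_ /andP[]]]|->] /=; lia.
  by rewrite gD; exact: nim_candidate_neq.
Qed.

End SubtractionGame.

Theorem theorem3p3 (a r : nat) (ha : 0 < a) (hr : 0 < r)
    (ha_even : ~~ odd a) (hr_even : ~~ odd r) (hra : r < a) :
  [/\ has_nim_sequence [fset 1; a; (a + r)%N]%fset (2 * a + r)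
        (word_pow [:: 0; 1] (a./2) ++ [:: 2] ++
         word_pow [:: 0; 1] (a./2) ++ word_pow [:: 2; 3] (r./2 - 1) ++ [:: 2]),
      r <> 2 ->
        least_period (nim_value [fset 1; a; (a + r)%N]%fset) (2 * a + r)
    & expansion [fset 1; a; (a + r)%N]%fset =
        star ([set 1] `|` [set s | ~~ odd s /\ a <= s <= a + r]
                `|` [set 2 * a + r - 1])
             (2 * a + r)].
Proof.
have GE : nim_value [fset 1; a; (a + r)%N]%fset = nim_candidate a r.
  by apply: boolp.funext => n; exact: nim_valueE_candidate.
rewrite /has_nim_sequence /expansion GE; split.
- split=> [||n]; first by rewrite !size_cat !size_word_pow /=; lia.
  + by split; [lia | exact: nim_candidate_period].
  + by rewrite nth_nim_word // ltn_mod; lia.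
- exact: nim_candidate_least_period.
- exact: nim_candidate_expansion.
Qed.
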